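(* Let $K=\mathbb{F}_q$, $S=K[t_1,\ldots,t_s]$, and let $\mathcal{X}=[A_1\times\cdots\times A_s]\subset\mathbb{P}^{s-1}$ be a projective nested cartesian set with $d_i=|A_i|$. Let $\prec$ be the lexicographical order with $t_1\prec\cdots\prec t_s$. If $0\neq f\in S_d$ is a standard polynomial of $S/I(\mathcal{X})$ with $1\leq d\leq\sum_{i=2}^s(d_i-1)$ and $t_1$ divides $\mathrm{in}_\prec(f)$, then $$|V_{\mathcal{X}}(f)|\leq\deg(S/I(\mathcal{X}))-(d_{k+2}-\ell+1)d_{k+3}\cdots d_s,$$ where $0\leq k\leq s-2$ and $\ell$ are the integers with $d=\sum_{i=2}^{k+1}(d_i-1)+\ell$ and $1\leq\ell\leq d_{k+2}-1$.
   Context: Projective nested cartesian set: for subsets $A_1,\ldots,A_s$ of $K$, $\mathcal{X}=[A_1\times\cdots\times A_s]$ is the image of $(A_1\times\cdots\times A_s)\setminus\{0\}$ under $K^s\setminus\{0\}\to\mathbb{P}^{s-1}$, $x\mapsto[x]$, and it is required that (i) $\{0,1\}\subset A_i$ for all $i$; (ii) $a/b\in A_j$ whenever $1\leq i<j\leq s$, $a\in A_j$, $0\neq b\in A_i$; (iii) $d_1\leq\cdots\leq d_s$ where $d_i=|A_i|$. $I(\mathcal{X})$ is the ideal generated by the homogeneous polynomials vanishing on $\mathcal{X}$; $V_{\mathcal{X}}(f)$ is the set of zeros of $f$ in $\mathcal{X}$. $\mathrm{in}_\prec(f)$ is the leading monomial. A standard polynomial is a nonzero $K$-linear combination of monomials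 not in the initial ideal $\mathrm{in}_\prec(I(\mathcal{X}))$. For a graded ideal $J$ with Hilbert function $H_J(d)=\dim_K(S_d/J_d)$ and $k=\dim(S/J)$, $\deg(S/J)=(k-1)!\lim_{d\to\infty}H_J(d)/d^{k-1}$ if $k\geq1$ and $\dim_K(S/J)$ if $k=0$. *)

(* Defs.v *)
From HB Require Import structures.
From mathcomp Require Import all_boot all_order all_algebra.
From mathcomp Require Import mpoly.
From Stdlib Require Import ClassicalEpsilon.
Set Implicit Arguments. Unset Strict Implicit. Unset Printing Implicit Defensive.
Import Order.TTheory GRing.Theory Num.Theory.
Local Open Scope ring_scope.

Section Defs.
Variables (K : fieldType) (s : nat).
Local Notation S := {mpoly K[s]}.

Definition asb (P : Prop) : bool :=
  if excluded_middle_informative P then true else false.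

(* ---- Lexicographic order with t_1 < t_2 < ... < t_s.
   Variable t_(i+1) is 'X_i (i : 'I_s).  m <lex m' iff at the largest index
   where they differ, m has the smaller exponent. *)
Definition lex_lt (m m' : 'X_{1..s}) : bool :=
  [exists i : 'I_s, (m i < m' i)%N && [forall j : 'I_s, (i < j)%N ==> (m j == m' j)]].

(* leading monomial in_<(f): maximum of the support for lex (0 if f = 0) *)
Definition lead_lex (f : S) : 'X_{1..s} :=
  foldr (fun m acc => if lex_lt acc m then m else acc) 0%MM (msupp f).

Definition gen_ideal (G : S -> Prop) (f : S) : Prop :=
  exists r : seq (S * S), (forall gh, gh \in r -> G gh.1) /\
                          f = \sum_(gh <- r) gh.1 * gh.2.

Definition initial_ideal (I : S -> Prop) : S -> Prop :=
  gen_ideal (fun g => exists h, I h /\ h != 0 /\ g = 'X_[lead_lex h]).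

Definition standard (I : S -> Prop) (f : S) : Prop :=
  f != 0 /\ forall m, m \in msupp f -> ~ initial_ideal I 'X_[m].

(* ---- Hilbert function H_J(d) = dim_K (S_d / J_d):
   qdim_ge J d n: there are n homogeneous degree-d polynomials linearly
   independent modulo J. *)
Definition qdim_ge (J : S -> Prop) (d n : nat) : Prop :=
  exists p : 'I_n -> S, (forall i, p i \is d.-homog) /\
    forall c : 'I_n -> K, J (\sum_(i < n) c i *: p i) -> forall i, c i = 0.

(* dim S_d <= (d+1)^s, so the maximum below is the dimension *)
Definition hilbert_fn (J : S -> Prop) (d : nat) : nat :=
  \max_(n < ((d.+1) ^ s).+1 | asb (qdim_ge J d n)) n.

(* deg(S/J) = e, where k = dim(S/J) is the growth order of H_J:
   k = 0: H_J eventually 0 and deg = dim_K(S/J) = sum_d H_J(d);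
   k >= 1: H_J(d)/d^(k-1) -> deg/(k-1)! with deg > 0. *)
Definition is_degree (J : S -> Prop) (e : rat) : Prop :=
  (exists N : nat, (forall d, (N <= d)%N -> hilbert_fn J d = 0%N) /\
                   e = (\sum_(d < N) hilbert_fn J d)%:R)
  \/
  (exists k : nat, (1 <= k)%N /\ 0 < e /\
     forall eps : rat, 0 < eps -> exists N : nat, forall d : nat, (N <= d)%N ->
       `| (hilbert_fn J d)%:R / (d%:R ^+ (k.-1)) - e / ((k.-1)`!)%:R | < eps).

End Defs.

Section Proj.
Variables (K : finFieldType) (s : nat).
Local Notation S := {mpoly K[s]}.

Definition proj_pt (x : {ffun 'I_s -> K}) : {set {ffun 'I_s -> K}} :=
  [set [ffun j => c * x j] | c in [set c : K | c != 0]].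

(* A : nat -> {set K}, indexed 1..s as in the paper (A 1, ..., A s);
   coordinate j : 'I_s (i.e. t_(j+1)) ranges over A j.+1 *)
Definition proj_cart (A : nat -> {set K}) : {set {set {ffun 'I_s -> K}}} :=
  [set proj_pt x | x in [set x : {ffun 'I_s -> K} |
                           [forall j, x j \in A j.+1] && (x != [ffun=> 0])]].

Definition vanishing_ideal (X : {set {set {ffun 'I_s -> K}}}) : S -> Prop :=
  gen_ideal (fun g => exists d, g \is d.-homog /\
                      forall P, P \in X -> forall x, x \in P -> g.@[x] = 0).

Definition zeros_in (X : {set {set {ffun 'I_s -> K}}}) (f : S) :=
  [set P in X | [forall x in P, f.@[x] == 0]].

End Proj.
Arguments proj_cart {K} s A.

(* Main.v *)
(* The ideal I(X) contains t_1 * prod_(a in A_j) (t_j - a t_1) for j >= 2, with leading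
   monomial t_1 t_j^(d_j); so in(f) = t^m has m_j < d_j for j >= 2, and m_2 + ... + m_s < d
   because m_1 > 0.  The footprint bound in the affine chart t_1 = 1 then yields at least
   prod_(j >= 2) (d_j - m_j) points of X where f does not vanish, and this product is
   smallest when the exponents are exhausted greedily from the smallest d_j upwards.
   Finally deg(S/I(X)) = |X|, since forms of degree d >= |X| separate the points of X. *)
Require Import Defs.
From HB Require Import structures.
From mathcomp Require Import all_boot all_order all_algebra.
From mathcomp Require Import mpoly.
From mathcomp Require Import zify lra.
Import Order.TTheory GRing.Theory Num.Theory.
Local Open Scope ring_scope.

Set Implicit Arguments.
Unset Strict Implicit.

(** * Greedy minimisation of a product under a sum constraint *)

(* The product of the e_i + 1 - a_i when a_1 + a_2 + ... = t is spent on the earliest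
   entries first, each a_i being capped at e_i. *)
Fixpoint greedy_prod (e : seq nat) (t : nat) : nat :=
  if e is x :: e' then
    if (x <= t)%N then greedy_prod e' (t - x)
    else ((x.+1 - t) * \prod_(y <- e') y.+1)%N
  else 1%N.

Lemma greedy_prod_cat (u v : seq nat) (t : nat) :
  greedy_prod (u ++ v) (\sum_(x <- u) x + t) = greedy_prod v t.
Proof.
elim: u => [|x u IH] /=; first by rewrite big_nil.
by rewrite big_cons -addnA leq_addr addKn.
Qed.

(** As no entry is below [c], spending [c] more units crosses at most one boundary between entries.
    With [w] the part of them falling on the next entry [y], the crossing case reduces to
    [w * (y - c) >= 0]. *)
Lemma greedy_prod_shift (e : seq nat) (t c : nat) :
  sorted leq e -> all (leq c) e ->
  (greedy_prod e t <= c.+1 * greedy_prod e (t + c))%N.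
Proof.
elim: e t => [|x e IH] t //= se /andP[cx ce].
have se' : sorted leq e by apply: path_sorted se.
case: (leqP x t) => [xt|tx].
  have -> : (x <= t + c)%N by lia.
  have -> : (t + c - x = t - x + c)%N by lia.
  exact: IH.
case: (leqP x (t + c)) => [xtc|tcx]; last first.
  rewrite mulnA leq_mul2r; apply/orP; right; nia.
case: e se ce {se' IH} => [|y e] /=; first by rewrite big_nil; lia.
move=> /andP[xy _] /andP[cy _].
have -> : (y <= t + c - x)%N = false by lia.
rewrite big_cons !mulnA leq_mul2r; apply/orP; right; nia.
Qed.

(** Exchange argument: by induction the tail may be taken greedy, and then units are moved from the
    tail to the head until the head is full or the tail is empty. *)
Lemma greedy_prod_le (T : Type) (r : seq T) (e a : T -> nat) :
  sorted leq (map e r) -> all (fun i => a i <= e i)%N r ->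
  (greedy_prod (map e r) (\sum_(i <- r) a i) <= \prod_(i <- r) ((e i).+1 - a i))%N.
Proof.
elim: r => [|i r IH] /=; first by rewrite big_nil.
move=> se /andP[ai ar]; rewrite !big_cons.
have se' : sorted leq (map e r) by apply: path_sorted se.
have le_ei : all (leq (e i)) (map e r).
  by apply: order_path_min se; apply: leq_trans.
apply: leq_trans (leq_mul (leqnn _) (IH se' ar)).
set t := (\sum_(_ <- _) _)%N.
have lec : all (leq (e i - a i)) (map e r).
  by apply: sub_all le_ei => y; apply: leq_trans; apply: leq_subr.
case: (leqP (e i) (a i + t)) => [le|lt].
  (* The head is filled by taking [e i - a i] units from the tail; the factor lost there is at most
     the head's own factor. *)
  have := greedy_prod_shift (a i + t - e i)%N se' lec.
  have -> : (a i + t - e i + (e i - a i) = t)%N by lia.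
  by have -> : ((e i - a i).+1 = (e i).+1 - a i)%N; first lia.
have tlt : (t < e i - a i)%N by lia.
have t_nil : r = [::] -> t = 0%N by rewrite /t => ->; rewrite big_nil.
clearbody t; case: r t_nil le_ei {IH se se' ar lec} => [|j r] /= t_nil.
  by rewrite big_nil t_nil //; lia.
move=> /andP[eij _].
have -> : (e j <= t)%N = false by lia.
rewrite big_cons !mulnA leq_mul2r; apply/orP; right; nia.
Qed.

Lemma greedy_prod_le_prod (e : seq nat) (t : nat) :
  (greedy_prod e t <= \prod_(y <- e) y.+1)%N.
Proof.
elim: e t => [|x e IH] t /=; first by rewrite big_nil.
rewrite big_cons; case: ifP => _; last by rewrite leq_mul2r leq_subr orbT.
by apply: leq_trans (IH _) _; rewrite leq_pmull.
Qed.

Lemma greedy_prod_anti (e : seq nat) (t t' : nat) :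
  (t <= t')%N -> (greedy_prod e t' <= greedy_prod e t)%N.
Proof.
elim: e t t' => [|x e IH] t t' tt' //=; case: (leqP x t) => [xt|tx].
  by rewrite (leq_trans xt tt'); apply: IH; rewrite leq_sub2r.
case: ifP => _; last by rewrite leq_mul2r leq_sub2l ?orbT.
by apply: leq_trans (greedy_prod_le_prod _ _) _; rewrite leq_pmull // subn_gt0 ltnW.
Qed.

(** * Null combinations and functionals on a finite set of scalars *)

Lemma exists_null_combination (K : fieldType) (T N : finType) (B : {set N})
    (phi : T -> N -> K) :
  (#|B| < #|T|)%N ->
  exists c : T -> K, (exists t, c t != 0) /\
    forall n, n \in B -> \sum_t c t * phi t n = 0.
Proof.
move=> ltBT; pose M := \matrix_(i < #|T|, j < #|B|) phi (enum_val i) (enum_val j).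
have : kermx M != 0.
  rewrite kermx_eq0 /row_free neq_ltn; apply/orP; left.
  exact: leq_ltn_trans (rank_leq_col M) ltBT.
case/rowV0Pn => v /sub_kermxP vM0 v0; exists (fun t => v 0 (enum_rank t)); split.
  case/rV0Pn: v0 => j vj; exists (enum_val j); by rewrite enum_valK.
move=> n nB; transitivity ((v *m M) 0 (enum_rank_in nB n)); last by rewrite vM0 mxE.
rewrite mxE (reindex (@enum_val T T)) /=; last exact: onW_bij (@enum_val_bij T).
apply: eq_bigr => i _; by rewrite mxE enum_valK enum_rankK_in.
Qed.

(** A divided difference on [n.+1] points of [B]: the [n] lower power conditions admit nonzero
    weights. If these also killed the [n]-th power, they would kill every polynomial of degree at
    most [n], in particular the product [P] vanishing at all chosen points except one of nonzero
    weight. *)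
Lemma exists_leading_functional (K : finFieldType) (B : {set K}) (n : nat) :
  (n < #|B|)%N ->
  exists w : K -> K, [/\ forall a, a \notin B -> w a = 0,
    forall i, (i < n)%N -> \sum_a w a * a ^+ i = 0 & \sum_a w a * a ^+ n != 0].
Proof.
move=> ltnB; pose p (t : 'I_n.+1) : K := enum_val (widen_ord ltnB t).
have p_inj : injective p by move=> t u /enum_val_inj /(congr1 val) /= /val_inj.
have [|c [[t0 ct0] c0]] := @exists_null_combination K 'I_n.+1 'I_n setT
  (fun t k => p t ^+ k).
  by rewrite cardsT !card_ord.
pose w a := \sum_(t | p t == a) c t.
have wE g : \sum_a w a * g a = \sum_t c t * g (p t).
  rewrite (partition_big p predT) //=; apply: eq_bigr => a _.
  by rewrite mulr_suml; apply: eq_bigr => t /eqP <-.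
have wlt i : (i < n)%N -> \sum_a w a * a ^+ i = 0.
  by move=> ltin; rewrite wE -[RHS](c0 (Ordinal ltin)) ?inE.
exists w; split=> //.
  move=> a aB; rewrite /w big1 // => t /eqP pt.
  by move: aB; rewrite -pt /p enum_valP.
apply: contraNneq ct0 => wn0.
pose P : {poly K} := \prod_(u <- [seq p u | u <- enum 'I_n.+1 & u != t0]) ('X - u%:P).
have szP : size P = n.+1.
  rewrite size_prod_XsubC size_map size_filter.
  have := count_predC (pred1 t0) (enum 'I_n.+1).
  rewrite size_enum_ord count_uniq_mem ?enum_uniq // mem_enum /=.
  by rewrite add1n => -[->].
have : \sum_t c t * P.[p t] = 0.
  rewrite -wE (eq_bigr (fun a => \sum_(i < n.+1) P`_i * (w a * a ^+ i))); last first.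
    move=> a _; rewrite horner_coef szP mulr_sumr; apply: eq_bigr => i _.
    by rewrite mulrCA.
  rewrite exchange_big big1 //= => i _; rewrite -mulr_sumr.
  have := ltn_ord i; rewrite ltnS leq_eqVlt => /orP[/eqP->|/wlt->].
    by rewrite wn0 mulr0.
  by rewrite mulr0.
rewrite (bigD1 t0) //= big1 => [|t tt0].
  rewrite addr0 => /eqP; rewrite mulf_eq0 => /orP[//|].
  rewrite -rootE root_prod_XsubC => /mapP[u].
  by rewrite mem_filter => /andP[ut0 _] /p_inj tu; rewrite tu eqxx in ut0.
suff /eqP-> : P.[p t] == 0 by rewrite mulr0.
rewrite -rootE root_prod_XsubC; apply/mapP; exists t => //.
by rewrite mem_filter tt0 mem_enum.
Qed.

(** * Lexicographic order and leading monomials *)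

Lemma lex_ltP (s : nat) (m m' : 'X_{1..s}) :
  reflect (exists2 i : 'I_s, (m i < m' i)%N & forall j : 'I_s, (i < j)%N -> m j = m' j)
          (lex_lt m m').
Proof.
apply: (iffP existsP) => [[i /andP[mi /forallP mj]]|[i mi mj]]; exists i => //.
  by move=> j ij; have := mj j; rewrite ij => /eqP.
by rewrite mi; apply/forallP => j; apply/implyP => /mj ->.
Qed.

Lemma lex_lt_irr (s : nat) (m : 'X_{1..s}) : lex_lt m m = false.
Proof. by apply/lex_ltP => -[i]; rewrite ltnn. Qed.

Lemma lex_lt_trans (s : nat) : transitive (@lex_lt s).
Proof.
move=> m2 m1 m3 /lex_ltP[i mi mj] /lex_ltP[i' mi' mj']; apply/lex_ltP.
case: (ltngtP i i') => ii'.
- exists i' => [|j i'j]; first by rewrite mj.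
  by rewrite mj ?mj' //; apply: ltn_trans i'j.
- exists i => [|j ij]; first by rewrite -mj'.
  by rewrite mj ?mj' //; apply: ltn_trans ij.
- move/val_inj: ii' mi' mj' => <- mi' mj'.
  exists i => [|j ij]; first exact: ltn_trans mi'.
  by rewrite mj ?mj'.
Qed.

Lemma lex_lt_total (s : nat) (m m' : 'X_{1..s}) :
  m != m' -> lex_lt m m' || lex_lt m' m.
Proof.
move=> mm'; have [i0 mi0] : exists i, m i != m' i.
  apply/existsP; apply: contraNT mm'; rewrite negb_exists => /forallP eqm.
  by apply/eqP/mnmP => i; apply/eqP; rewrite -[_ == _]negbK.
case: (@arg_maxnP _ i0 (fun i => m i != m' i) val mi0) => i mi imax.
have mj (j : 'I_s) : (i < j)%N -> m j = m' j.
  by move=> ij; apply/eqP; apply: contraTT ij => /imax; rewrite -leqNgt.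
move: mi; rewrite neq_ltn => /orP[] mi; apply/orP; [left|right]; apply/lex_ltP;
  by exists i => // j /mj.
Qed.

Lemma lead_lexP (K : fieldType) (s : nat) (f : {mpoly K[s]}) : f != 0 ->
  lead_lex f \in msupp f /\
  forall m, m \in msupp f -> m != lead_lex f -> lex_lt m (lead_lex f).
Proof.
rewrite -msupp_eq0 /lead_lex; move: (msupp f) => r r0.
set l := foldr _ _ _.
have [l_in l_max] : (l = 0%MM \/ l \in r) /\
    forall m, m \in r -> m != l -> lex_lt m l.
  rewrite /l; clear l r0; elim: r => [|m r [IH1 IH2]] /=; first by split; [left|].
  move: (foldr _ _ r) IH1 IH2 => l IH1 IH2; case: ifPn => lm; split.
  - by right; rewrite mem_head.
  - move=> m'; rewrite inE => /orP[/eqP->|m'r _]; first by rewrite eqxx.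
    have [->//|m'l] := eqVneq m' l; exact: lex_lt_trans (IH2 _ m'r m'l) lm.
  - by case: IH1 => [->|lr]; [left|right]; rewrite // inE lr orbT.
  - move=> m'; rewrite inE => /orP[/eqP->|/IH2//].
    by move/lex_lt_total => /orP[//|]; rewrite (negbTE lm).
(* The fold starts at 0, which might lie outside the support. But nothing is below 0, so if the
   maximum is 0 then the first support monomial is already 0. *)
split=> //; clearbody l; case: l_in => // l0; rewrite l0 in l_max *.
case: r r0 l_max => [//|m r] _ l_max.
have [<-|m0] := eqVneq m 0%MM; first exact: mem_head.
by have /lex_ltP[i] := l_max m (mem_head _ _) m0; rewrite mnm0E.
Qed.

Lemma lead_lex_unique (K : fieldType) (s : nat) (f : {mpoly K[s]}) (m : 'X_{1..s}) :
  m \in msupp f -> (forall m', m' \in msupp f -> m' != m -> lex_lt m' m) ->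
  lead_lex f = m.
Proof.
move=> mf m_max; have f0 : f != 0.
  by apply: contraTneq mf => ->; rewrite msupp0.
have [l_in l_max] := lead_lexP f0; apply/eqP; apply: contraT => lm.
have := lex_lt_trans (m_max _ l_in lm) (l_max _ mf _).
by rewrite lex_lt_irr eq_sym => ->.
Qed.

(* For monomials of equal degree, lex comparison is decided off the smallest variable. *)
Definition lex_off0 (s : nat) (m m' : 'X_{1..s}) : Prop :=
  exists i : 'I_s, [/\ (0 < i)%N, (m i < m' i)%N &
                       forall j : 'I_s, (i < j)%N -> m j = m' j].

Lemma lex_off0_lex_lt (s : nat) (m m' : 'X_{1..s}) : lex_off0 m m' -> lex_lt m m'.
Proof. by case=> i [_ mi mj]; apply/lex_ltP; exists i. Qed.

(** If the deciding index were 0, all other exponents would agree and the degrees would differ. This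
    is how homogeneity of the given form is used. *)
Lemma lex_lt_mdeg (s : nat) (m m' : 'X_{1..s}) :
  mdeg m = mdeg m' -> lex_lt m m' -> lex_off0 m m'.
Proof.
move=> eqd /lex_ltP[i mi mj]; exists i; split=> //.
rewrite lt0n; apply: contraPneq eqd => i0; apply/eqP; rewrite neq_ltn !mdegE.
rewrite (bigD1 i) //= [X in (_ < X)%N](bigD1 i) //=.
rewrite (eq_bigr m') ?ltn_add2r ?mi // => j ji; apply: mj.
by rewrite i0 lt0n; apply: contraNneq ji => j0; apply/eqP/val_inj; rewrite /= i0.
Qed.

(** Meant for the multiplier [g] of the footprint bound, which need not be homogeneous but does not
    involve the smallest variable. *)
Lemma lex_lt_eq0 (s : nat) (m m' : 'X_{1..s}) :
  (forall i : 'I_s, val i = 0%N -> m i = m' i) -> lex_lt m m' -> lex_off0 m m'.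
Proof.
move=> eq0 /lex_ltP[i mi mj]; exists i; split=> //.
by rewrite lt0n; apply: contraTneq mi => /eq0 ->; rewrite ltnn.
Qed.

Lemma lex_off0_trans (s : nat) (m1 m2 m3 : 'X_{1..s}) :
  lex_off0 m1 m2 -> lex_off0 m2 m3 -> lex_off0 m1 m3.
Proof.
move=> [i [i0 mi mj]] [i' [i'0 mi' mj']].
case: (ltngtP i i') => ii'.
- exists i'; split=> // [|j i'j]; first by rewrite mj.
  by rewrite mj ?mj' //; apply: ltn_trans i'j.
- exists i; split=> // [|j ij]; first by rewrite -mj'.
  by rewrite mj ?mj' //; apply: ltn_trans ij.
- move/val_inj: ii' mi' mj' => <- mi' mj'.
  exists i; split=> // [|j ij]; first exact: ltn_trans mi'.
  by rewrite mj ?mj'.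
Qed.

Lemma lex_off0_add2r (s : nat) (n m m' : 'X_{1..s}) :
  lex_off0 m m' -> lex_off0 (m + n)%MM (m' + n)%MM.
Proof.
case=> i [i0 mi mj]; exists i; split=> //; first by rewrite !mnmDE ltn_add2r.
by move=> j ij; rewrite !mnmDE mj.
Qed.

Lemma lex_off0_add2l (s : nat) (n m m' : 'X_{1..s}) :
  lex_off0 m m' -> lex_off0 (n + m)%MM (n + m')%MM.
Proof. by rewrite ![(n + _)%MM]addmC; apply: lex_off0_add2r. Qed.

Lemma lex_off0_add (s : nat) (m1 m2 n1 n2 : 'X_{1..s}) :
  (m1 != n1 -> lex_off0 m1 n1) -> (m2 != n2 -> lex_off0 m2 n2) ->
  (m1, m2) != (n1, n2) -> lex_off0 (m1 + m2)%MM (n1 + n2)%MM.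
Proof.
rewrite xpair_eqE negb_and.
have [->|_] := eqVneq m1 n1; have [->|_] := eqVneq m2 n2 => //= h1 h2 _.
- by apply: lex_off0_add2l; apply: h2.
- by apply: lex_off0_add2r; apply: h1.
- by apply: lex_off0_trans (lex_off0_add2r _ (h1 _)) (lex_off0_add2l _ (h2 _)).
Qed.

(** A leading monomial that stays strictly largest after the smallest variable is set to 1. *)
Definition lead_off0 (K : fieldType) (s : nat) (f : {mpoly K[s]}) (m : 'X_{1..s}) :=
  m \in msupp f /\ forall m', m' \in msupp f -> m' != m -> lex_off0 m' m.

(** The order is compatible with products, so only the pair [(m, n)] contributes to the coefficient
    of [m + n]. *)
Lemma lead_off0M (K : fieldType) (s : nat) (f g : {mpoly K[s]}) (m n : 'X_{1..s}) :
  lead_off0 f m -> lead_off0 g n -> lead_off0 (f * g) (m + n)%MM.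
Proof.
move=> [mf m_max] [ng n_max].
have addlt m' n' : m' \in msupp f -> n' \in msupp g -> (m', n') != (m, n) ->
    lex_off0 (m' + n')%MM (m + n)%MM.
  by move=> m'f n'g; apply: lex_off0_add; [apply: m_max|apply: n_max].
have addneq m' n' : m' \in msupp f -> n' \in msupp g -> (m', n') != (m, n) ->
    (m' + n' == m + n)%MM = false.
  move=> m'f n'g ne; apply/eqP => e; have := addlt _ _ m'f n'g ne.
  by rewrite e => /lex_off0_lex_lt; rewrite lex_lt_irr.
split.
  rewrite mcoeff_msupp mpolyME raddf_sum big_allpairs /=.
  rewrite (bigD1_seq m) ?msupp_uniq //= (bigD1_seq n) ?msupp_uniq //=.
  rewrite mcoeffZ mcoeffX eqxx mulr1 big_seq_cond big1 => [|n' /andP[n'g n'n]].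
    rewrite addr0 big_seq_cond big1 => [|m' /andP[m'f m'm]].
      by rewrite addr0 mulf_neq0 // -mcoeff_msupp.
    rewrite big_seq big1 // => n' n'g; rewrite mcoeffZ mcoeffX addneq ?mulr0 //.
    by rewrite xpair_eqE negb_and m'm.
  by rewrite mcoeffZ mcoeffX addneq ?mulr0 // xpair_eqE negb_and n'n orbT.
move=> p /msuppM_le /allpairsP[[m' n'] /= [m'f n'g ->]] ne.
by apply: addlt => //; apply: contraNneq ne => -[-> ->].
Qed.

(** * The footprint bound in an affine chart *)

Definition grid (K : finFieldType) (s : nat) (B : 'I_s -> {set K}) :
  {set {ffun 'I_s -> K}} := [set x : {ffun 'I_s -> K} | [forall i, x i \in B i]].

(* The tensor product of the functionals of exists_leading_functional in the variables
   other than the smallest one (evaluated at 1) kills all monomials of f but n. *)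
Lemma grid_nonvanishing (K : finFieldType) (s : nat) (B : 'I_s -> {set K})
    (f : {mpoly K[s]}) (n : 'X_{1..s}) :
  (forall i : 'I_s, val i = 0%N -> B i = [set 1]) ->
  (forall i : 'I_s, (0 < i)%N -> (n i < #|B i|)%N) ->
  lead_off0 f n -> exists2 x, x \in grid B & f.@[x] != 0.
Proof.
move=> B0 nB [nf n_max].
have /fin_all_exists[w wP] (i : 'I_s) : exists w : K -> K,
    [/\ forall a, a \notin B i -> w a = 0,
        forall k, (0 < i)%N -> (k < n i)%N -> \sum_a w a * a ^+ k = 0 &
        \sum_a w a * a ^+ (n i) != 0].
  case: (posnP i) => [i0|i_gt0]; last first.
    have [w [w1 w2 w3]] := exists_leading_functional (nB i i_gt0).
    by exists w; split=> // k _; apply: w2.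
  (* Point mass at 1: the smallest variable is evaluated at 1, which takes every power of it to
     1. *)
  exists (fun a => (a == 1)%:R); split=> // [a|].
    by rewrite B0 // inE => /negbTE->.
  rewrite (bigD1 1) //= eqxx mul1r expr1n big1 ?addr0 ?oner_neq0 //.
  by move=> a /negbTE ->; rewrite mul0r.
pose Phi (g : {ffun 'I_s -> K} -> K) :=
  \sum_(x : {ffun 'I_s -> K}) (\prod_i w i (x i)) * g x.
have PhiX m : Phi (fun x => \prod_i x i ^+ m i) = \prod_i \sum_a w i a * a ^+ m i.
  by rewrite bigA_distr_bigA /=; apply: eq_bigr => x _; rewrite big_split.
have Phif : Phi (fun x => f.@[x]) = f@_n * \prod_i \sum_a w i a * a ^+ n i.
  transitivity (\sum_(m <- msupp f) f@_m * Phi (fun x => \prod_i x i ^+ m i)).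
    rewrite /Phi; under [RHS]eq_bigr do rewrite mulr_sumr.
    rewrite exchange_big /=; apply: eq_bigr => x _; rewrite mevalE mulr_sumr.
    by apply: eq_bigr => m _; rewrite mulrCA.
  rewrite (bigD1_seq n) ?msupp_uniq //= PhiX [X in _ + X]big_seq_cond.
  rewrite [X in _ + X]big1 ?addr0 //.
  (* Another monomial [m] has a smaller exponent than [n] at some index [i > 0], so its [i]-th
     factor is zero. *)
  move=> m /andP[mf mn]; have [i [i0 mi _]] := n_max m mf mn.
  have [_ wi _] := wP i.
  by rewrite PhiX [X in _ * X](bigD1 i) //= wi // mul0r mulr0.
have : Phi (fun x => f.@[x]) != 0.
  rewrite Phif mulf_neq0 -?mcoeff_msupp //.
  by apply/prodf_neq0 => i _; have [] := wP i.
case: (pickP (fun x => (x \in grid B) && (f.@[x] != 0))) => [x /andP[]|none].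
  by exists x.
rewrite /Phi big1 ?eqxx // => x _; have := none x; rewrite inE.
case: forallP => [_ /= /negbFE/eqP->|/forallP]; first by rewrite mulr0.
rewrite negb_forall => /existsP[i xi] _.
by have [wi _ _] := wP i; rewrite (bigD1 i) //= wi // !mul0r.
Qed.

(* Footprint bound: otherwise some combination g of the monomials t^b with b_i < |B_i| - m_i
   vanishes where f does not, and g f contradicts grid_nonvanishing. *)
Lemma footprint_bound (K : finFieldType) (s : nat) (B : 'I_s -> {set K})
    (f : {mpoly K[s]}) (m : 'X_{1..s}) :
  (forall i : 'I_s, val i = 0%N -> B i = [set 1]) ->
  (forall i : 'I_s, (0 < i)%N -> (m i < #|B i|)%N) ->
  lead_off0 f m ->
  (\prod_(i < s | (0 < i)%N) (#|B i| - m i) <= #|[set x in grid B | f.@[x] != 0%R]|)%N.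
Proof.
(* Range 1 at index 0 forces exponent 0 there, so the monomials [mon b] avoid the smallest variable
   and number exactly the product to be bounded. *)
move=> B0 mB fm; pose r (i : 'I_s) := if (0 < i)%N then (#|B i| - m i)%N else 1%N.
pose T := {dffun forall i : 'I_s, 'I_(r i)}.
have cardT : #|T| = (\prod_(i < s | (0 < i)%N) (#|B i| - m i))%N.
  rewrite card_dep_ffun foldrE big_map big_enum /= [RHS]big_mkcond /=.
  by apply: eq_bigr => i _; rewrite card_ord.
rewrite -cardT leqNgt; apply/negP => lt.
pose mon (b : T) : 'X_{1..s} := [multinom (b i : nat) | i < s].
have mon_inj : injective mon.
  move=> b b' /mnmP e; apply/ffunP => i; apply/val_inj.
  by have := e i; rewrite !mnmE.
have [c [[b0 cb0] c0]] :=
  exists_null_combination (fun (b : T) (x : {ffun 'I_s -> K}) => 'X_[mon b].@[x]) lt.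
pose g : {mpoly K[s]} := \sum_b c b *: 'X_[mon b].
have gb b : g@_(mon b) = c b.
  rewrite raddf_sum /= (bigD1 b) //= mcoeffZ mcoeffX eqxx mulr1 big1 ?addr0 // => b' bb'.
  by rewrite mcoeffZ mcoeffX (inj_eq mon_inj) (negbTE bb') mulr0.
have g_supp n : n \in msupp g -> exists b, n = mon b.
  case: (pickP (fun b => n == mon b)) => [b /eqP->|none]; first by exists b.
  rewrite mcoeff_msupp raddf_sum /= big1 ?eqxx // => b _.
  by rewrite mcoeffZ mcoeffX eq_sym none mulr0.
have mon0 b (i : 'I_s) : val i = 0%N -> mon b i = 0%N.
  rewrite mnmE => i0; have := ltn_ord (b i).
  by rewrite [X in (_ < X)%N]/r lt0n [nat_of_ord i]i0; case: (b i : nat).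
have g0 : g != 0 by apply: contraNneq cb0 => g0; rewrite -gb g0 mcoeff0.
have [lg l_max] := lead_lexP g0; set l := lead_lex g in lg l_max.
have lead_g : lead_off0 g l.
  split=> // m' m'g m'l; apply: lex_lt_eq0 (l_max _ m'g m'l) => i i0.
  have [[b ->] [b' ->]] := (g_supp _ m'g, g_supp _ lg).
  by rewrite !mon0.
(* The product [g * f] has leading exponents [b i + m i < #|B i|] for [i > 0], hence is nonzero
   somewhere on the grid. *)
have [|x xB] := grid_nonvanishing B0 _ (lead_off0M lead_g fm).
  move=> i i0; have [b ->] := g_supp _ lg; rewrite mnmDE mnmE.
  by have := ltn_ord (b i); rewrite [X in (_ < X)%N]/r i0 ltn_subRL addnC.
rewrite mevalM mulf_eq0 negb_or => /andP[gx fx]; case/eqP: gx.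
rewrite raddf_sum /= -[RHS](c0 x); last by rewrite inE xB.
by apply: eq_bigr => b _; rewrite mevalZ.
Qed.

(** * Projective points, the vanishing ideal and its initial monomials *)

Lemma meval_dhomog (K : fieldType) (s d : nat) (g : {mpoly K[s]})
    (x : {ffun 'I_s -> K}) (c : K) :
  g \is d.-homog -> g.@[[ffun j => c * x j]] = c ^+ d * g.@[x].
Proof.
move=> /dhomogP gd; rewrite !mevalE mulr_sumr; apply: eq_big_seq => m /gd /= <-.
rewrite mulrCA mdegE -prodrXr /= -big_split /=; congr (_ * _).
by apply: eq_bigr => i _; rewrite ffunE exprMn.
Qed.

Lemma proj_ptP (K : finFieldType) (s : nat) (x y : {ffun 'I_s -> K}) :
  reflect (exists2 c, c != 0 & y = [ffun j => c * x j]) (y \in proj_pt x).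
Proof.
by apply: (iffP imsetP) => -[c]; rewrite ?inE => c0 ->; exists c; rewrite ?inE.
Qed.

Lemma proj_pt_id (K : finFieldType) (s : nat) (x : {ffun 'I_s -> K}) : x \in proj_pt x.
Proof.
by apply/proj_ptP; exists 1; rewrite ?oner_neq0 //; apply/ffunP=> j; rewrite ffunE mul1r.
Qed.

Lemma proj_pt_eq (K : finFieldType) (s : nat) (x y : {ffun 'I_s -> K}) :
  y \in proj_pt x -> proj_pt y = proj_pt x.
Proof.
case/proj_ptP => c c0 ->; apply/setP => z; apply/proj_ptP/proj_ptP => -[a a0 ->].
  by exists (a * c); rewrite ?mulf_neq0 //; apply/ffunP=> j; rewrite !ffunE mulrA.
exists (a / c); rewrite ?mulf_neq0 ?invr_eq0 //; apply/ffunP=> j.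
by rewrite !ffunE mulrA divfK.
Qed.

Lemma proj_cartP (K : finFieldType) (s : nat) (A : nat -> {set K})
    (P : {set {ffun 'I_s -> K}}) :
  reflect (exists y : {ffun 'I_s -> K},
             [/\ y != [ffun=> 0], forall j : 'I_s, y j \in A j.+1 & P = proj_pt y])
          (P \in proj_cart s A).
Proof.
apply: (iffP imsetP) => [[y]|[y [y0 yA ->]]].
  by rewrite inE => /andP[/forallP yA y0 ->]; exists y.
by exists y; rewrite // inE y0 andbT; apply/forallP.
Qed.

Lemma vanishing_ideal_meval (K : finFieldType) (s : nat)
    (X : {set {set {ffun 'I_s -> K}}}) (g : {mpoly K[s]})
    (P : {set {ffun 'I_s -> K}}) (x : {ffun 'I_s -> K}) :
  vanishing_ideal X g -> P \in X -> x \in P -> g.@[x] = 0.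
Proof.
case=> r [rX ->] PX xP; rewrite raddf_sum /= big_seq big1 // => gh /rX[d [_ gh0]].
by rewrite mevalM (gh0 P) ?mul0r.
Qed.

Lemma mem_vanishing_ideal (K : finFieldType) (s d : nat)
    (X : {set {set {ffun 'I_s -> K}}}) (g : {mpoly K[s]}) :
  g \is d.-homog -> (forall P, P \in X -> forall x, x \in P -> g.@[x] = 0) ->
  vanishing_ideal X g.
Proof.
move=> gd g0; exists [:: (g, 1)]; split; last by rewrite big_seq1 mulr1.
by move=> gh; rewrite inE => /eqP->; exists d.
Qed.

(* t_1 * prod_(a in A_j) (t_j - a t_1) lies in the ideal and has leading monomial
   t_1 t_j^(d_j). *)
Lemma standard_exponent_lt (K : finFieldType) (s : nat) (A : nat -> {set K})
    (hAdiv : forall i j, (1 <= i)%N -> (i < j)%N -> (j <= s)%N ->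
       forall a b : K, a \in A j -> b \in A i -> b != 0 -> a / b \in A j)
    (f : {mpoly K[s]}) (m : 'X_{1..s}) (o j : 'I_s) :
  standard (vanishing_ideal (proj_cart s A)) f -> m \in msupp f ->
  val o = 0%N -> (0 < m o)%N -> (0 < j)%N -> (m j < #|A j.+1|)%N.
Proof.
move=> [_ f_std] mf o0 mo j0; rewrite ltnNge; apply/negP => le_mj.
apply: (f_std m mf); set n := #|A j.+1| in le_mj *.
have oj : (o == j) = false.
  by apply: contraTF j0 => /eqP <-; rewrite o0.
(* With [p] and [h] below, [h] is [t_1] times the homogenisation of the product of the
   [t_j - a t_1], and [M n] is [t_1 t_j^n]. *)
pose M i : 'X_{1..s} := (U_(o) *+ (n.+1 - i) + U_(j) *+ i)%MM.
have ME i k : M i k = ((o == k) * (n.+1 - i) + (j == k) * i)%N.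
  by rewrite mnmDE !mulmnE !mnm1E.
pose p : {poly K} := \prod_(a in A j.+1) ('X - a%:P).
have sz_p : size p = n.+1 by rewrite /p -big_enum /= size_prod_XsubC -cardE.
have p_monic : p \is monic by apply: monic_prod => a _; apply: monicXsubC.
pose h : {mpoly K[s]} := \sum_(i < n.+1) p`_i *: 'X_[M i].
have hMn : h@_(M n) = 1.
  rewrite raddf_sum /= big_ord_recr /= mcoeffZ mcoeffX eqxx mulr1 big1.
    by move/monicP: p_monic; rewrite lead_coefE sz_p add0r.
  move=> i _; rewrite mcoeffZ mcoeffX; case: eqP => [/mnmP/(_ j)|_]; last first.
    by rewrite mulr0.
  rewrite !ME eqxx oj !mul1n => /eqP; rewrite /= eqn_add2l => /eqP e.
  by have := ltn_ord i; rewrite e ltnn.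
have h_supp m' : m' \in msupp h -> exists i : 'I_n.+1, m' = M i.
  case: (pickP (fun i : 'I_n.+1 => m' == M i)) => [i /eqP->|none]; first by exists i.
  rewrite mcoeff_msupp raddf_sum /= big1 ?eqxx // => i _.
  by rewrite mcoeffZ mcoeffX eq_sym none mulr0.
have h_lead : lead_lex h = M n.
  apply: lead_lex_unique => [|m' /h_supp[i ->] ne]; first by rewrite mcoeff_msupp hMn oner_neq0.
  have lt_in : (i < n)%N.
    by rewrite ltn_neqAle -ltnS ltn_ord andbT; apply: contraNneq ne => ->.
  apply/lex_ltP; exists j; first by rewrite !ME eqxx oj; lia.
  move=> k jk; rewrite !ME; have -> : (o == k) = false.
    by apply: contraTF jk => /eqP <-; rewrite -leqNgt o0.
  by have -> : (j == k) = false by apply: contraTF jk => /eqP <-; rewrite ltnn.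
have h_homog : h \is n.+1.-homog.
  apply: rpred_sum => i _; apply: rpredZ; rewrite dhomogX /= mdegD !mdegMn !mdeg1 !mul1n.
  by rewrite subnK // ltnW.
have h_van : vanishing_ideal (proj_cart s A) h.
  apply: (mem_vanishing_ideal h_homog) => P /proj_cartP[y [_ yA ->]] x /proj_ptP[c c0 ->].
  rewrite (meval_dhomog _ _ h_homog) -[RHS](mulr0 (c ^+ n.+1)); congr (_ * _).
  have MX i : 'X_[M i].@[y] = y o ^+ (n.+1 - i) * y j ^+ i.
    by rewrite mpolyXD -!mpolyXn mevalM !rmorphXn /= !mevalXU.
  (* The extra factor [t_1] settles the points with [y o = 0]: every exponent [n.+1 - i] is
     positive. *)
  rewrite raddf_sum /=; have [yo0|yo0] := eqVneq (y o) 0.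
    rewrite big1 // => i _; rewrite mevalZ MX yo0 expr0n subn_eq0 leqNgt ltn_ord.
    by rewrite mul0r mulr0.
  transitivity (y o ^+ n.+1 * p.[y j / y o]).
    rewrite horner_coef sz_p mulr_sumr; apply: eq_bigr => i _.
    rewrite mevalZ MX [RHS]mulrCA; congr (_ * _).
    have -> : y o ^+ n.+1 = y o ^+ (n.+1 - i) * y o ^+ i.
      by rewrite -exprD subnK // ltnW.
    by rewrite exprMn exprVn -mulrA [X in _ = _ * X]mulrCA divff ?mulr1 ?expf_neq0.
  (* Nestedness with first index 1 makes the quotient a root of [p]. *)
  have yjA : y j / y o \in A j.+1.
    by apply: (hAdiv 1%N) => //; have := yA o; rewrite o0.
  by rewrite horner_prod (bigD1 _ yjA) /= hornerXsubC subrr mul0r mulr0.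
(* Since [m o >= 1] and [m j >= n], the leading monomial of [h] divides [m], against
   standardness. *)
exists [:: ('X_[M n], 'X_[(m - M n)])]; split.
  move=> gh; rewrite inE => /eqP-> /=; exists h; split=> //; split; last by rewrite h_lead.
  by apply: contraTneq (oner_neq0 K) => h0; rewrite -hMn h0 mcoeff0 eqxx.
rewrite big_seq1 /= -mpolyXD addmC submK //; apply/mnm_lepP => k; rewrite ME.
case: eqP => [<-|_]; first by rewrite eq_sym oj /=; lia.
by case: eqP => [<-|_]; lia.
Qed.

(** A nonzero 2 by 2 minor of the pair yields the linear form [y_j t_i - y_i t_j]; if all minors
    vanish, the vectors are proportional. *)
Lemma proj_pt_separation (K : finFieldType) (s : nat) (x y : {ffun 'I_s -> K}) :
  x != [ffun=> 0] -> y != [ffun=> 0] -> proj_pt x != proj_pt y ->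
  exists l : {mpoly K[s]}, [/\ l \is 1.-homog, l.@[x] != 0 & l.@[y] = 0].
Proof.
move=> x0 y0 xy.
case: (pickP (fun ij : 'I_s * 'I_s => y ij.2 * x ij.1 - y ij.1 * x ij.2 != 0)).
  move=> [i j] /= ne; exists (y j *: 'X_i - y i *: 'X_j); split.
  - by rewrite rpredB // rpredZ // dhomogX /= mdeg1.
  - by rewrite mevalB !mevalZ !mevalXU.
  - by rewrite mevalB !mevalZ !mevalXU mulrC subrr.
move=> eqxy; case/eqP: xy; apply/esym/proj_pt_eq.
have [i xi] : exists i, x i != 0.
  apply/existsP; apply: contraNT x0; rewrite negb_exists => /forallP xi.
  by apply/eqP/ffunP => i; rewrite ffunE; apply/eqP; rewrite -[_ == _]negbK.
have yE : y = [ffun j => y i / x i * x j].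
  apply/ffunP => j; rewrite ffunE; have /negbFE := eqxy (i, j); rewrite /= subr_eq0.
  by move/eqP => e; rewrite mulrAC -e mulfK.
apply/proj_ptP; exists (y i / x i) => //; apply: contraNneq y0 => c0.
by rewrite yE; apply/eqP/ffunP => j; rewrite !ffunE c0 mul0r.
Qed.

(** * The Hilbert function and the degree *)

Section HilbertFunction.
Variables (K : finFieldType) (s : nat) (X : {set {set {ffun 'I_s -> K}}}).
Hypothesis X_proj : forall P, P \in X -> exists2 x, x != [ffun=> 0] & P = proj_pt x.

Let rep (P : {set {ffun 'I_s -> K}}) : {ffun 'I_s -> K} :=
  odflt [ffun=> 0] [pick x | (x != [ffun=> 0]) && (P == proj_pt x)].

Let repP P : P \in X -> rep P != [ffun=> 0] /\ P = proj_pt (rep P).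
Proof.
move=> /X_proj[x x0 Px]; rewrite /rep; case: pickP => [y /andP[y0 /eqP Py]|/(_ x)] //=.
by rewrite x0 Px eqxx.
Qed.

(** With more forms than points, some nontrivial combination vanishes at all representatives, hence
    by homogeneity on all of [X]. *)
Lemma qdim_ge_card (d n : nat) : qdim_ge (vanishing_ideal X) d n -> (n <= #|X|)%N.
Proof.
case=> p [pd p_free]; rewrite leqNgt; apply/negP => lt.
have [|c [[i ci] c0]] := @exists_null_combination K 'I_n _ X
  (fun i P => (p i).@[rep P]); first by rewrite card_ord.
case/eqP: ci; apply: p_free; have hd : \sum_(i < n) c i *: p i \is d.-homog.
  by apply: rpred_sum => k _; apply: rpredZ.
apply: (mem_vanishing_ideal hd) => P PX x; have [_ ->] := repP PX.
case/proj_ptP => a _ ->; rewrite (meval_dhomog _ _ hd) raddf_sum /=.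
under eq_bigr do rewrite mevalZ.
by rewrite c0 // mulr0.
Qed.

(** The product of one separating linear form per point of [r]. *)
Lemma separating_form (r : seq {set {ffun 'I_s -> K}}) (P : {set {ffun 'I_s -> K}}) :
  P \in X -> {subset r <= X} -> P \notin r ->
  exists g : {mpoly K[s]},
    [/\ g \is (size r).-homog, g.@[rep P] != 0 & forall Q, Q \in r -> g.@[rep Q] = 0].
Proof.
move=> PX; elim: r => [|Q r IH] rX Pr.
  by exists 1; split; rewrite // ?dhomog1 // meval1 oner_neq0.
move: Pr; rewrite inE negb_or => /andP[PQ Pr].
have [|//|g [gd gP gr]] := IH; first by move=> R Rr; apply: rX; rewrite inE Rr orbT.
have QX : Q \in X by apply: rX; rewrite mem_head.
have [P0 eP] := repP PX; have [Q0 eQ] := repP QX.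
have [|l [ld lP lQ]] := proj_pt_separation P0 Q0; first by rewrite -eP -eQ.
exists (l * g); split; first exact: (dhomogM ld gd).
  by rewrite mevalM mulf_neq0.
by move=> R; rewrite inE mevalM => /orP[/eqP->|/gr->]; rewrite ?lQ ?mul0r ?mulr0.
Qed.

(** Forms dual to the points are independent: evaluating a relation at the [i]-th point isolates its
    [i]-th coefficient. *)
Lemma qdim_ge_vanishing_ideal (d : nat) :
  (#|X| <= d)%N -> qdim_ge (vanishing_ideal X) d #|X|.
Proof.
move=> le_d.
have /fin_all_exists[p pP] (i : 'I_#|X|) : exists g : {mpoly K[s]},
    [/\ g \is d.-homog, g.@[rep (enum_val i)] != 0 &
        forall j : 'I_#|X|, j != i -> g.@[rep (enum_val j)] = 0].
  pose r := [seq Q <- enum X | Q != enum_val i].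
  have PX := enum_valP i.
  have [||g [gd gP gr]] := @separating_form r _ PX.
  - by move=> Q; rewrite mem_filter mem_enum => /andP[].
  - by rewrite mem_filter eqxx.
  have le_r : (size r <= d)%N.
    by apply: leq_trans le_d; rewrite size_filter cardE count_size.
  (* A power of a coordinate that is nonzero at the point pads the separating form to degree exactly
     [d]. *)
  have [k xk] : exists k, rep (enum_val i) k != 0.
    have [P0 _] := repP PX.
    apply/existsP; apply: contraNT P0; rewrite negb_exists => /forallP xi.
    by apply/eqP/ffunP => j; rewrite ffunE; apply/eqP; rewrite -[_ == _]negbK.
  exists (g * 'X_k ^+ (d - size r)); split.
  - have Xd : ('X_k : {mpoly K[s]}) ^+ (d - size r) \is (d - size r).-homog.
      by rewrite mpolyXn dhomogX /= mdegMn mdeg1 mul1n.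
    by have := dhomogM gd Xd; rewrite subnKC.
  - by rewrite mevalM rmorphXn /= mevalXU mulf_neq0 ?expf_neq0.
  - move=> j ji; rewrite mevalM gr ?mul0r // mem_filter mem_enum enum_valP andbT.
    by apply: contraNneq ji => /enum_val_inj ->.
exists p; split=> [i|c]; first by have [] := pP i.
move=> cp i; have [_ pi _] := pP i; have iX := enum_valP i.
have := vanishing_ideal_meval cp iX; have [_ {1}->] := repP iX.
move/(_ _ (proj_pt_id _)); rewrite raddf_sum (bigD1 i) //= mevalZ big1 => [|j ji].
  by rewrite addr0 => /eqP; rewrite mulf_eq0 (negbTE pi) orbF => /eqP.
by have [_ _ pj] := pP j; rewrite mevalZ pj ?mulr0 // eq_sym.
Qed.

Lemma hilbert_fn_vanishing_ideal (d : nat) :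
  (0 < s)%N -> (#|X| <= d)%N -> hilbert_fn (vanishing_ideal X) d = #|X|.
Proof.
move=> s0 le_d; apply/eqP; rewrite eqn_leq; apply/andP; split.
  apply/bigmax_leqP => n; rewrite /asb.
  by case: ClassicalEpsilon.excluded_middle_informative => // hn _; exact: qdim_ge_card hn.
(* The value [#|X|] must lie in the range of the maximum defining [hilbert_fn]; [0 < s] gives
   [d.+1 <= d.+1 ^ s]. *)
have lt : (#|X| < ((d.+1) ^ s).+1)%N.
  rewrite ltnS (leq_trans le_d) // (leq_trans (leqnSn d)) //.
  by rewrite -{1}(expn1 d.+1) leq_pexp2l.
apply: (leq_trans _ (leq_bigmax_cond (Ordinal lt) _)) => //=.
rewrite /asb; case: ClassicalEpsilon.excluded_middle_informative => // nX.
by case: nX; apply: qdim_ge_vanishing_ideal.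
Qed.

End HilbertFunction.

(** A positive constant has growth order exactly [k = 1]: for [k = 0] it would be eventually zero,
    and for larger [k] the quotient tends to 0 although [e > 0]. *)
Lemma is_degree_eventually_const (K : fieldType) (s : nat) (J : {mpoly K[s]} -> Prop)
    (N c : nat) (e : rat) :
  (0 < c)%N -> (forall d, (N <= d)%N -> hilbert_fn J d = c) ->
  is_degree J e <-> e = c%:R.
Proof.
move=> c0 Jc; split=> [|->]; last first.
  right; exists 1%N; split=> //; split=> [|eps eps0]; first by rewrite ltr0n.
  by exists N => d /Jc ->; rewrite expr0 fact0 subrr normr0.
case=> [[N' [J0 _]]|[[|k] [+ [e0 lim]]]] // => [|_].
  have := Jc _ (leq_maxl N N'); rewrite J0 ?leq_maxr // => c0'.
  by rewrite -c0' in c0.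
case: k lim => [|k] lim.
  apply/eqP; rewrite eq_sym -subr_eq0; apply: contraT; rewrite -normr_gt0 => /lim[N' lim'].
  by have := lim' _ (leq_maxr N N'); rewrite Jc ?leq_maxl // expr0 fact0 !divr1 ltxx.
set u := e / _ in lim; have u0 : 0 < u by rewrite divr_gt0 // ltr0n fact_gt0.
have u20 : 0 < u / 2 by rewrite divr_gt0.
have [N' lim'] := lim _ u20.
(* For this [d] the quotient is below [u / 2], yet it must be within [u / 2] of [u]. *)
pose d := maxn (maxn N N') (Num.bound (c%:R / (u / 2))).+1.
have Nd : (N <= d)%N by rewrite /d; lia.
have N'd : (N' <= d)%N by rewrite /d; lia.
have cd : c%:R / (u / 2) < d%:R :> rat.
  have ge0 : 0 <= c%:R / (u / 2) by rewrite divr_ge0 // ltW.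
  by apply: lt_le_trans (archi_boundP ge0) _; rewrite ler_nat /d; lia.
have d1 : 1 <= d%:R :> rat by rewrite ler1n /d; lia.
have d0 : 0 < d%:R :> rat by apply: lt_le_trans d1.
have := lim' d N'd; rewrite Jc // => lt.
have lt2 : c%:R / d%:R ^+ k.+1 < u / 2.
  rewrite ltr_pdivrMr ?exprn_gt0 //; move: cd; rewrite ltr_pdivrMr // mulrC => cd.
  by apply: lt_le_trans cd _; rewrite ler_pM2l // exprS ler_peMr ?exprn_ege1 // ltW.
by move: lt; rewrite ltr_norml => /andP[lt _]; lra.
Qed.

(** * The numerical bound, the count of zeros and the conclusion *)

Lemma prod_exponent_bound (s : nat) (c a : nat -> nat) (k l : nat) :
  (forall i j, (1 <= i)%N -> (i <= j)%N -> (j <= s)%N -> (c i <= c j)%N) ->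
  (forall i, (2 <= i <= s)%N -> (a i < c i)%N) ->
  (\sum_(2 <= i < s.+1) a i < \sum_(2 <= i < k.+2) (c i - 1) + l)%N ->
  (k.+2 <= s)%N -> (1 <= l <= c k.+2 - 1)%N ->
  ((c k.+2 - l + 1) * \prod_(k.+3 <= i < s.+1) c i <=
   \prod_(2 <= i < s.+1) (c i - a i))%N.
Proof.
move=> c_mono a_lt lt_sum ks /andP[l0 lc].
have c_pos i : (2 <= i <= s)%N -> (c i - 1).+1 = c i.
  by move/a_lt; case: (c i) => // x _; rewrite subn1.
have -> : (\prod_(2 <= i < s.+1) (c i - a i) =
           \prod_(2 <= i < s.+1) ((c i - 1).+1 - a i))%N.
  by apply: eq_big_nat => i i_s; rewrite c_pos.
apply: leq_trans (greedy_prod_le (e := fun i => (c i - 1)%N) _ _); last first.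
- by apply/allP => i; rewrite mem_index_iota ltnS => /a_lt; lia.
- apply: (homo_sorted_in (P := fun i => (2 <= i <= s)%N)) (iota_sorted _ _).
    move=> i j /andP[i2 _] /andP[_ js] ij.
    by rewrite leq_sub2r // c_mono // ltnW.
  by apply/allP => i; rewrite mem_index_iota ltnS.
(* Strictness of the sum bound leaves [l.-1] units for entry [k.+2]; this is the source of the [+ 1]
   in [c k.+2 - l + 1]. *)
have le_sum : (\sum_(2 <= i < s.+1) a i <= \sum_(2 <= i < k.+2) (c i - 1) + l.-1)%N by lia.
apply: leq_trans (greedy_prod_anti _ le_sum).
(* Cut at [k.+2]: the greedy choice fills every earlier entry and leaves the later ones
   untouched. *)
have -> : index_iota 2 s.+1 = index_iota 2 k.+2 ++ k.+2 :: index_iota k.+3 s.+1.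
  rewrite /index_iota -[k.+2 :: _]/(iota k.+2 (s.+1 - k.+3).+1).
  have -> : ((s.+1 - k.+3).+1 = s.+1 - k.+2)%N by lia.
  have {1}-> : (s.+1 - 2 = (k.+2 - 2) + (s.+1 - k.+2))%N by lia.
  by rewrite iotaD; congr (_ ++ iota _ _); lia.
rewrite map_cat -[(\sum_(2 <= i < k.+2) _)%N](big_map (fun i => c i - 1)%N xpredT id).
rewrite greedy_prod_cat /=.
have -> : (c k.+2 - 1 <= l.-1)%N = false by lia.
rewrite big_map; apply: leq_mul; first by lia.
by apply: eq_leq; apply: eq_big_nat => i i_s; rewrite c_pos //; lia.
Qed.

(** Vectors with coordinate [o] equal to 1 represent distinct projective points, and those of [N]
    lie in the set but off the zeros of [f]. *)
Lemma card_zeros_in_le (K : finFieldType) (s : nat) (A : nat -> {set K})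
    (f : {mpoly K[s]}) (N : {set {ffun 'I_s -> K}}) (o : 'I_s) :
  (forall x, x \in N -> [/\ x o = 1, forall j : 'I_s, x j \in A j.+1 & f.@[x] != 0]) ->
  (#|zeros_in (proj_cart s A) f| + #|N| <= #|proj_cart s A|)%N.
Proof.
move=> NP; have pt_inj : {in N &, injective (@proj_pt K s)}.
  move=> x y /NP[xo _ _] /NP[yo _ _] xy; have := proj_pt_id y; rewrite -xy.
  case/proj_ptP => c _ yE; have /eqP := congr1 (fun z : {ffun 'I_s -> K} => z o) yE.
  rewrite ffunE xo yo mulr1 => /eqP c1; apply/ffunP => j.
  by rewrite yE ffunE -c1 mul1r.
rewrite -(card_in_imset pt_inj) -leq_subRL; last first.
  by apply/subset_leq_card/subsetP => P; rewrite inE => /andP[].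
have -> : (#|proj_cart s A| - #|zeros_in (proj_cart s A) f| =
           #|proj_cart s A :\: zeros_in (proj_cart s A) f|)%N.
  rewrite cardsD (setIidPr _) //.
  by apply/subsetP => P; rewrite inE => /andP[].
apply/subset_leq_card/subsetP => _ /imsetP[x /NP[xo xA fx] ->].
rewrite !inE; apply/andP; split.
  rewrite negb_and; apply/orP; right; rewrite negb_forall; apply/existsP; exists x.
  by rewrite proj_pt_id.
apply/proj_cartP; exists x; split=> //.
by apply: contraNneq (oner_neq0 K) => x0; rewrite -xo x0 ffunE.
Qed.

Unset Implicit Arguments.

Theorem theorem6p6 (K : finFieldType) (s : nat) (A : nat -> {set K})
  (* (i) {0,1} ⊂ A_i *)
  (hA01 : forall i, (1 <= i <= s)%N -> (0 : K) \in A i /\ (1 : K) \in A i)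
  (* (ii) a/b ∈ A_j for i < j, a ∈ A_j, 0 ≠ b ∈ A_i *)
  (hAdiv : forall i j, (1 <= i)%N -> (i < j)%N -> (j <= s)%N ->
     forall a b : K, a \in A j -> b \in A i -> b != 0 -> a / b \in A j)
  (* (iii) d_1 <= ... <= d_s *)
  (hAmono : forall i j, (1 <= i)%N -> (i <= j)%N -> (j <= s)%N -> (#|A i| <= #|A j|)%N)
  (f : {mpoly K[s]}) (d : nat)
  (hf0 : f != 0) (hfd : f \is d.-homog)
  (hfstd : standard (vanishing_ideal (proj_cart s A)) f)
  (hd1 : (1 <= d)%N) (hd2 : (d <= \sum_(2 <= i < s.+1) (#|A i| - 1))%N)
  (ht1 : forall i : 'I_s, val i = 0%N -> (0 < lead_lex f i)%N)
  (k l : nat) (hk : (k <= s - 2)%N)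
  (hdkl : d = (\sum_(2 <= i < k.+2) (#|A i| - 1) + l)%N)
  (hl : (1 <= l <= #|A (k.+2)| - 1)%N) :
  (exists e : rat, is_degree (vanishing_ideal (proj_cart s A)) e) /\
  forall e : rat, is_degree (vanishing_ideal (proj_cart s A)) e ->
    (#|zeros_in (proj_cart s A) f|)%:R <=
      e - ((#|A (k.+2)| - l + 1) * \prod_(k.+3 <= i < s.+1) #|A i|)%N%:R.
Proof.
(* For [s < 2] the sum bounding [d] would be empty. *)
have s2 : (2 <= s)%N.
  by rewrite leqNgt; apply/negP => lt; move: (leq_trans hd1 hd2); rewrite big_geq.
have [n sE] : exists n, s = n.+1 by exists s.-1; rewrite prednK // ltnW.
subst s.
set X := proj_cart n.+1 A; set m := lead_lex f in ht1 *.
have Xproj P : P \in X -> exists2 x, x != [ffun=> 0] & P = proj_pt x.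
  by case/proj_cartP => y [y0 _ ->]; exists y.
have X0 : (0 < #|X|)%N.
  apply/card_gt0P; exists (proj_pt [ffun=> 1]); apply/proj_cartP.
  exists [ffun=> 1]; split=> // [|j].
    by apply: contraNneq (oner_neq0 K) => /ffunP/(_ ord0); rewrite !ffunE => ->.
  by rewrite ffunE; have [] := hA01 j.+1 (ltn_ord j).
have degX e := is_degree_eventually_const e X0
  (fun d' => @hilbert_fn_vanishing_ideal K n.+1 X Xproj d' (ltn0Sn n)).
split=> [|e]; first by exists #|X|%:R; apply/degX.
move=> /degX ->; rewrite lerBrDr -natrD ler_nat.
have [mf m_max] := lead_lexP hf0; rewrite -/m in mf m_max.
have deg_m m' : m' \in msupp f -> mdeg m' = d by move/dhomogP: hfd; apply.
have f_lead : lead_off0 f m.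
  split=> // m' m'f m'm; apply: lex_lt_mdeg (m_max _ m'f m'm).
  by rewrite !deg_m.
(* The chart [t_1 = 1] as a grid. *)
pose B (i : 'I_n.+1) := if val i == 0%N then [set 1] else A i.+1.
have B_pos (i : 'I_n.+1) : (0 < i)%N -> B i = A i.+1.
  by rewrite /B lt0n => /negbTE ->.
have m_lt (i : 'I_n.+1) : (0 < i)%N -> (m i < #|A i.+1|)%N.
  by apply: (standard_exponent_lt hAdiv hfstd mf (o := ord0)) => //; apply: ht1.
have fp : (\prod_(i < n.+1 | (0 < i)%N) (#|B i| - m i) <=
           #|[set x in grid B | f.@[x] != 0%R]|)%N.
  apply: footprint_bound f_lead => i i0; first by rewrite /B i0.
  by rewrite B_pos // m_lt.
have zN := @card_zeros_in_le K n.+1 A f [set x in grid B | f.@[x] != 0] ord0.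
apply: leq_trans (zN _) => [|x]; last first.
  rewrite !inE => /andP[/forallP xB fx]; split=> // [|j].
    by have := xB ord0; rewrite /B inE => /eqP.
  have := xB j; rewrite /B; case: eqP => // _; rewrite inE => /eqP->.
  by have [] := hA01 j.+1 (ltn_ord j).
rewrite leq_add2l; apply: leq_trans fp.
(* Reindexing from 1: [a i] is the exponent of [t_i]. *)
pose a i := m (inord i.-1 : 'I_n.+1).
have aE (i : 'I_n) : a i.+2 = m (lift ord0 i).
  by rewrite /a; congr (m _); apply/val_inj; rewrite /= inordK // ltnS.
have -> : (\prod_(i < n.+1 | (0 < i)%N) (#|B i| - m i) =
           \prod_(2 <= i < n.+2) (#|A i| - a i))%N.
  rewrite big_mkcond big_ord_recl /= mul1n big_add1 big_add1 big_mkord /=.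
  by apply: eq_bigr => i _; rewrite aE B_pos.
apply: prod_exponent_bound => //.
- move=> [|[|i]] // /andP[_ i_n]; rewrite (aE (Ordinal (i_n : (i < n)%N))).
  exact: m_lt.
(* The exponents of [t_2, ..., t_s] sum to less than [d] because [t_1] divides the leading
   monomial. *)
- rewrite -hdkl -(deg_m m mf) mdegE big_ord_recl big_add1 big_add1 big_mkord /=.
  rewrite (eq_bigr (fun i => m (lift ord0 i))) => [|i _]; last exact: aE.
  by rewrite -[X in (X < _)%N]add0n ltn_add2r ht1.
- by move: hk s2; lia.
Qed.
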